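(* Let $Q=Q(v_1,v_2,v_3,v_4)\subset\mathbb{C}$ be any Jordan quadrilateral. Then there exists a disk $D\subset Q$ such that $\partial D\cap\partial Q$ contains points of three sides of $Q$ (that is, $\partial D$ meets at least three of the four sides $a_1,b_1,a_2,b_2$). In particular, $\partial D\cap\partial Q$ contains points from two opposite sides of $Q$.
   Context: A Jordan quadrilateral $Q=Q(v_1,v_2,v_3,v_4)\subset\mathbb{C}$ is a bounded Jordan domain (the bounded open region enclosed by a Jordan curve $\partial Q$) together with four distinct marked points $v_1,v_2,v_3,v_4\in\partial Q$, called quad-vertices, listed in counter-clockwise order along $\partial Q$. The sides of $Q$ are the four Jordan subarcs of $\partial Q$ joining consecutive quad-vertices, endpoints included: $a_1$ from $v_1$ to $v_2$, $b_1$ from $v_2$ to $v_3$, $a_2$ from $v_3$ to $v_4$, and $b_2$ from $v_4$ to $v_1$. Opposite sides are the pairs of non-intersecting sides, i.e. $\{a_1,a_2\}$ and $\{b_1,b_2\}$. A disk is an open Euclidean disk of positive radius. Points of $\partial D\cap\partial Q$ on different sides are not required to be distinct: a quad-vertex counts as a point of both sides containing it. *)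

(* Defs.v *)
From mathcomp Require Import all_boot all_order all_algebra.
From mathcomp Require Import all_classical all_reals all_analysis.
From mathcomp.real_closed Require Export complex.

Set Implicit Arguments.
Unset Strict Implicit.
Unset Printing Implicit Defensive.

Import Order.TTheory GRing.Theory Num.Theory.
Import numFieldNormedType.Exports.
Local Open Scope classical_set_scope.
Local Open Scope ring_scope.
Local Open Scope complex_scope.

(* The alias ^o carries the topology of the modulus, so that [ball c r%:C] is
   the open Euclidean disk [set z | `|c - z| < r%:C]. *)
Notation plane R := ((R : realType)[i]^o).

Definition frontier (T : topologicalType) (A : set T) : set T :=
  closure A `\` A°.

Definition touches (T : Type) (A B : set T) : Prop := A `&` B !=set0.

Section JordanQuadrilateral.
Variable R : realType.
Implicit Types (gamma : R -> plane R) (Q a b : set (plane R)) (z v : plane R).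

(* Only the values of [gamma] on [0, 1] are relevant. *)
Definition jordan_loop gamma : Prop :=
  [/\ {within `[0, 1], continuous gamma},
      gamma 0 = gamma 1 &
      {in `[0, 1[ &, injective gamma}].

Definition loop_trace gamma : set (plane R) := gamma @` `[0, 1].

(* By the Jordan curve theorem there is exactly one bounded component [Q] of
   the complement, and [frontier Q = loop_trace gamma]. *)
Definition jordan_domain gamma Q : Prop :=
  bounded_set Q /\
  exists2 z, (~` loop_trace gamma) z & Q = connected_component (~` loop_trace gamma) z.

(* [theta] is a continuous determination of the argument of [gamma - z]. *)
Definition has_winding_number gamma z (n : int) : Prop :=
  exists theta : R -> R,
    [/\ {within `[0, 1], continuous theta},
        {in `[0, 1], forall t,
          gamma t - z = `|gamma t - z| * (cos (theta t) +i* sin (theta t))} &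
        theta 1 - theta 0 = n%:~R * (2 * pi)].

Definition counterclockwise gamma Q : Prop :=
  forall z, Q z -> has_winding_number gamma z 1.

(* The marked points are distinct because [gamma] is injective on [0, 1[. *)
Definition jordan_quadrilateral Q v1 v2 v3 v4 a1 b1 a2 b2 : Prop :=
  exists (gamma : R -> plane R) (t2 t3 t4 : R),
    [/\ [/\ jordan_loop gamma, jordan_domain gamma Q & counterclockwise gamma Q],
        [&& 0 < t2, t2 < t3, t3 < t4 & t4 < 1],
        [/\ v1 = gamma 0, v2 = gamma t2, v3 = gamma t3 & v4 = gamma t4] &
        [/\ a1 = gamma @` `[0, t2], b1 = gamma @` `[t2, t3],
            a2 = gamma @` `[t3, t4] & b2 = gamma @` `[t4, 1]]].

End JordanQuadrilateral.

(* Main.v *)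
(** Merge the sides [b1] and [a2] into one arc. The boundary then consists of
    three arcs, and it suffices to find a point [w] of [Q] with equal distances
    [d1], [d2], [d3] to them: the disk about [w] with this radius lies in [Q]
    and touches [a1], [b2] and one of [b1], [a2]. Such points are the zeros of
    [f = - d1 + d2 e^(-i pi/3) + d3 e^(i pi/3)]. Along the boundary [f] does not
    vanish and turns once, exactly as the vector from a point [z] of [Q] does,
    since the winding number about [z] is 1. If [f] had no zero in [Q], a
    Borsuk-type gluing of [f / |f|] inside with the radial field from [z] outside
    (twisted by a Tietze extension of the difference of the angles) would extend
    the radial field of a large circle to a map of its disk to the unit circle,
    which is impossible. *)

Require Import Defs.
From mathcomp Require Import all_boot all_order all_algebra.
From mathcomp Require Import all_classical all_reals all_analysis.
From mathcomp Require Import ring lra.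

Set Implicit Arguments.
Unset Strict Implicit.
Unset Printing Implicit Defensive.

Import Order.TTheory GRing.Theory Num.Theory.
Import numFieldNormedType.Exports.
Local Open Scope classical_set_scope.
Local Open Scope ring_scope.
Local Open Scope complex_scope.

(** * Lifting circle-valued maps on a square to continuous angles *)

Section Lifting.
Context {R : realType}.
Implicit Types (a b : R) (p : R * R).

(** In the right half-plane [atan (b / a)] is an argument of [a + i b], and it varies continuously
    with the point. *)
Lemma cos_sin_atan a b : 0 < a ->
  a = Num.sqrt (a ^+ 2 + b ^+ 2) * cos (atan (b / a)) /\
  b = Num.sqrt (a ^+ 2 + b ^+ 2) * sin (atan (b / a)).
Proof.
move=> a0; have cE : a = Num.sqrt (a ^+ 2 + b ^+ 2) * cos (atan (b / a)).
  have -> : a ^+ 2 + b ^+ 2 = a ^+ 2 * (1 + (b / a) ^+ 2).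
    by field; rewrite gt_eqF.
  rewrite sqrtrM ?sqr_ge0// sqrtr_sqr gtr0_norm// cos_atan -mulrA mulfV ?mulr1//.
  by rewrite gt_eqF// sqrtr_gt0 ltr_wpDr ?sqr_ge0.
split=> //.
have c0 : cos (atan (b / a)) != 0.
  by apply/negP => /eqP c0; move: a0; rewrite cE c0 mulr0 ltxx.
have : tan (atan (b / a)) = b / a by rewrite atanK.
rewrite /tan => /(canRL (divfK c0)) ->.
by rewrite mulrCA -cE divfK// gt_eqF.
Qed.

Lemma unit_circle_arg a b : a ^+ 2 + b ^+ 2 = 1 ->
  exists t, a = cos t /\ b = sin t.
Proof.
move=> ab1; have a1 : -1 <= a <= 1.
  by rewrite -ler_norml -(@expr_le1 _ 2%N)// real_normK ?num_real//; nra.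
have ca : cos (acos a) = a by apply: acosK; rewrite in_itv.
have sa : sin (acos a) = `|b|.
  by rewrite sin_acos// -ab1 addrAC subrr add0r sqrtr_sqr.
have [b0|b0] := leP 0 b; [exists (acos a)|exists (- acos a)].
  by rewrite ca sa ger0_norm.
by rewrite cosN sinN ca sa ltr0_norm// opprK.
Qed.

(** For unit vectors the dot and cross products are the cosine and sine of the turn from [u] to [v];
    a positive dot product keeps this turn below a quarter, where [atan] recovers it. *)
Lemma unit_circle_rotate (u1 u2 v1 v2 t : R) :
  u1 = cos t -> u2 = sin t -> v1 ^+ 2 + v2 ^+ 2 = 1 -> 0 < u1 * v1 + u2 * v2 ->
  let t' := t + atan ((u1 * v2 - u2 * v1) / (u1 * v1 + u2 * v2)) in
  v1 = cos t' /\ v2 = sin t'.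
Proof.
move=> u1E u2E v1E dot0 /=.
have u1v1 : u1 ^+ 2 + u2 ^+ 2 = 1 by rewrite u1E u2E cos2Dsin2.
have [] := cos_sin_atan (u1 * v2 - u2 * v1) dot0.
have -> : (u1 * v1 + u2 * v2) ^+ 2 + (u1 * v2 - u2 * v1) ^+ 2 = 1.
  transitivity ((u1 ^+ 2 + u2 ^+ 2) * (v1 ^+ 2 + v2 ^+ 2)); first by ring.
  by rewrite u1v1 v1E mulr1.
rewrite sqrtr1 !mul1r => cE sE.
rewrite cosD sinD -cE -sE -u1E -u2E; split.
  by transitivity ((u1 ^+ 2 + u2 ^+ 2) * v1); [rewrite u1v1 mul1r | ring].
by transitivity ((u1 ^+ 2 + u2 ^+ 2) * v2); [rewrite u1v1 mul1r | ring].
Qed.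

(** The closed ball about 0 for the maximum norm, which is the norm of [R * R]; as a product it
    inherits compactness from segments. *)
Let square M : set (R * R) := `[- M, M] `*` `[- M, M].

Lemma compact_square M : compact (square M).
Proof. by apply: compact_setX; exact: segment_compact. Qed.

(** At [h = 0] the dot product is 1, so it stays positive for small [h] near each [p]; compactness
    of the square makes the bound on [h] uniform. *)
Lemma circle_map_unif_dot (X Y : R * R -> R) M :
  continuous X -> continuous Y -> (forall p, X p ^+ 2 + Y p ^+ 2 = 1) ->
  exists2 d, 0 < d & forall p h, square M p -> `|h| < d ->
    0 < X p * X (p + h) + Y p * Y (p + h).
Proof.
move=> cX cY XY1.
have nc : near_covering (square M).
  by apply/compact_near_coveringP; exact: compact_square.
have /nbhs_ballP[d /= d0 dH] : \forall h \near (0 : R * R),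
    square M `<=` (fun p => 0 < X p * X (p + h) + Y p * Y (p + h)).
  apply: (nc _ (nbhs (0 : R * R))
    (fun h p => 0 < X p * X (p + h) + Y p * Y (p + h))) => p _.
  have cf : {for (p, 0 : R * R), continuous (fun z : (R * R) * (R * R) =>
      X z.1 * X (z.1 + z.2) + Y z.1 * Y (z.1 + z.2))}.
    have c1 : {for (p, 0 : R * R), continuous (@fst (R * R) (R * R))}.
      exact: cvg_fst.
    have c2 : {for (p, 0 : R * R),
        continuous (fun z : (R * R) * (R * R) => z.1 + z.2)}.
      by apply: cvgD; [exact: cvg_fst|exact: cvg_snd].
    by apply: continuousD; apply: continuousM; apply: continuous_comp;
       rewrite //; [exact: cX|exact: cX|exact: cY|exact: cY].
  have := cf [set x | 0 < x] _; apply.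
  apply: open_nbhs_nbhs; split; first exact: open_gt.
  by rewrite /= addr0 -!expr2 XY1.
exists d => // p h Mp hd; apply: dH => //.
by rewrite -ball_normE /= sub0r normrN.
Qed.

Lemma scale_square M p (s : R) : square M p -> 0 <= s <= 1 -> square M (s *: p).
Proof.
rewrite /square /= !in_itv /= -!ler_norml !normrM => -[p1 p2] /andP[s0 s1].
rewrite ger0_norm//; have M0 : 0 <= M by apply: le_trans p1.
by split; rewrite -[leRHS]mul1r ler_pM.
Qed.

Lemma square_norm M p : square M p -> `|p| <= M.
Proof.
by rewrite /square /= !in_itv /= -!ler_norml => -[? ?]; rewrite prod_normE ge_max; apply/andP.
Qed.

(* The argument is accumulated along the ray from 0 to [p], cut into [n] steps
   so short that [(X, Y)] turns by less than a quarter turn on each. *)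
Lemma circle_map_lift (X Y : R * R -> R) M :
  continuous X -> continuous Y -> (forall p, X p ^+ 2 + Y p ^+ 2 = 1) ->
  exists theta : R * R -> R, forall p, square M p ->
    [/\ {for p, continuous theta}, X p = cos (theta p) & Y p = sin (theta p)].
Proof.
move=> cX cY XY1; have [d d0 dP] := circle_map_unif_dot M cX cY XY1.
have [t0 [t0c t0s]] := unit_circle_arg (XY1 0).
(* A point of the square has norm at most [M], so each of [n.+1] equal steps towards it is shorter
   than [d]. *)
have [n nP] : exists n : nat, M / n.+1%:R < d.
  exists (Num.bound (M / d)); rewrite ltr_pdivrMr ?ltr0n// mulrC -ltr_pdivrMr//.
  have [M0|M0] := leP 0 (M / d).
    by rewrite (lt_trans (archi_boundP M0))// ltr_nat.
  by rewrite (lt_le_trans M0).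
pose s k : R := k%:R / n.+1%:R.
(* Cosine and sine of the turn between consecutive division points of the ray. *)
pose dot k p := X (s k *: p) * X (s k.+1 *: p) + Y (s k *: p) * Y (s k.+1 *: p).
pose crs k p := X (s k *: p) * Y (s k.+1 *: p) - Y (s k *: p) * X (s k.+1 *: p).
pose theta := fix th k p :=
  if k is k'.+1 then th k' p + atan (crs k' p / dot k' p) else t0.
have dot0 k p : (k < n.+1)%N -> square M p -> 0 < dot k p.
  move=> kn Mp; rewrite /dot.
  have -> : s k.+1 *: p = s k *: p + n.+1%:R^-1 *: p.
    by rewrite -scalerDl /s -natr1 mulrDl mul1r.
  apply: dP.
    apply: scale_square => //; rewrite /s divr_ge0//=.
    by rewrite ler_pdivrMr// mul1r ler_nat ltnW.
  rewrite normrZ ger0_norm ?invr_ge0// mulrC.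
  by apply: le_lt_trans nP; rewrite ler_wpM2r ?invr_ge0//; exact: square_norm.
have thetaP k p : (k <= n.+1)%N -> square M p ->
    [/\ {for p, continuous (theta k)}, X (s k *: p) = cos (theta k p) &
        Y (s k *: p) = sin (theta k p)].
  elim: k => [_ _|k IH kn Mp].
    by rewrite /s mul0r scale0r; split=> //; exact: cvg_cst.
  have [ck Xk Yk] := IH (ltnW kn) Mp.
  have [Xk' Yk'] := unit_circle_rotate Xk Yk (XY1 (s k.+1 *: p)) (dot0 k p kn Mp).
  split=> //.
  have csc j : {for p, continuous (fun q : R * R => s j *: q)}.
    exact: scaler_continuous.
  have cXs j : {for p, continuous (fun q : R * R => X (s j *: q))}.
    by apply: continuous_comp; [exact: csc|exact: cX].
  have cYs j : {for p, continuous (fun q : R * R => Y (s j *: q))}.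
    by apply: continuous_comp; [exact: csc|exact: cY].
  apply: (@continuousD _ _ _ (theta k)) => //.
  apply: (@continuous_comp _ _ _ (fun q : R * R => crs k q / dot k q) (@atan R));
    last exact: continuous_atan.
  apply: continuousM.
    by apply: continuousB; apply: continuousM.
  apply: continuousV; first by rewrite gt_eqF ?dot0.
  by apply: continuousD; apply: continuousM.
exists (theta n.+1) => p Mp; have [] := thetaP n.+1 p (leqnn _) Mp.
by rewrite /s divff ?scale1r.
Qed.

End Lifting.

(** * Zeros of plane maps from winding numbers *)

Section WindingZero.
Context {R : realType}.
Implicit Types (p q w : R * R).

Local Notation N a b := (Num.sqrt ((a : R) ^+ 2 + b ^+ 2)).

Lemma continuous_pair (T : topologicalType) (f g : T -> R) t :
  {for t, continuous f} -> {for t, continuous g} ->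
  {for t, continuous (fun s => (f s, g s) : R * R)}.
Proof. by move=> cf cg; exact: (cvg_pair cf cg). Qed.

Lemma continuous_hypot (T : topologicalType) (f g : T -> R) t :
  {for t, continuous f} -> {for t, continuous g} ->
  {for t, continuous (fun s => N (f s) (g s))}.
Proof.
move=> cf cg.
apply: (@continuous_comp _ _ _ (fun s => f s ^+ 2 + g s ^+ 2) Num.sqrt);
  last exact: sqrt_continuous.
by apply: (@continuousD _ _ _ (fun s => f s ^+ 2) (fun s => g s ^+ 2));
  [apply: (@continuousM _ _ f f)|apply: (@continuousM _ _ g g)].
Qed.

(** A map of the plane to the unit circle lifts to an angle on a square containing the circle. The
    radial field turned by the single-valued angle [phi] gains a full turn along the circle, so it
    cannot be the restriction of such a map. *)
Lemma circle_map_no_ext (X Y phi : R * R -> R) (z : R * R) M : 0 <= M ->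
  continuous X -> continuous Y -> (forall p, X p ^+ 2 + Y p ^+ 2 = 1) ->
  continuous phi ->
  ~ (forall u, let w := z + (M * cos u, M * sin u) in
       X w = cos (phi w + u) /\ Y w = sin (phi w + u)).
Proof.
move=> M0 cX cY XY1 cphi XYE.
have cadd : continuous (fun p => z + p).
  by move=> p; apply: cvgD; [exact: cvg_cst|exact: cvg_id].
have [theta thetaP] := @circle_map_lift R (fun p => X (z + p)) (fun p => Y (z + p)) M
  (fun p => continuous_comp (cadd p) (cX _))
  (fun p => continuous_comp (cadd p) (cY _)) (fun p => XY1 (z + p)).
pose c u : R * R := (M * cos u, M * sin u).
have cM u : (`[- M, M] `*` `[- M, M]) (c u).
  have Mle (x : R) : `|x| <= 1 -> `|M * x| <= M.
    by move=> x1; rewrite normrM ger0_norm// ler_piMr.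
  by split; rewrite /= in_itv /= -ler_norml; apply: Mle;
     rewrite ler_norml ?cos_geN1 ?cos_le1 ?sin_geN1 ?sin_le1.
have cc : continuous c.
  move=> u; apply: (@continuous_pair _ (fun u => M * cos u) (fun u => M * sin u));
    (apply: continuousM; first exact: cvg_cst).
    exact: continuous_cos.
  exact: continuous_sin.
pose k u := theta (c u) - phi (z + c u) - u.
have ck : continuous k.
  move=> u; apply: (@continuousB _ _ _
    (fun u => theta (c u) - phi (z + c u)) (fun u => u)); last exact: cvg_id.
  apply: (@continuousB _ _ _ (fun u => theta (c u)) (fun u => phi (z + c u))).
    by apply: (@continuous_comp _ _ _ c theta); [exact: cc|have [] := thetaP _ (cM u)].
  apply: (@continuous_comp _ _ _ (fun u => z + c u) phi); last exact: cphi.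
  by apply: (@continuous_comp _ _ _ c (fun p => z + p)); [exact: cc|exact: cadd].
have cosk u : cos (k u) = 1.
  have [_ tX tY] := thetaP _ (cM u); have [] := XYE u.
  rewrite -/(c u) => fX fY.
  rewrite /k -addrA -opprD cosB -tX -tY -fX -fY.
  by rewrite -!expr2 XY1.
have k2pi : k (2 * pi) = k 0 - 2 * pi.
  have c2pi : c (2 * pi) = c 0.
    by rewrite /c mulr_natl -[X in cos X]add0r cosD2pi -[X in sin X]add0r sinD2pi.
  by rewrite /k c2pi subr0.
have pi0 := @pi_ge0 R.
(* All values of [k] have cosine 1, but [k] drops by 2 pi and so passes through [k 0 - pi], whose
   cosine is -1. *)
have [|||u _ ku] := @IVT R k 0 (2 * pi) (k 0 - pi).
- by rewrite mulr_ge0.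
- exact: continuous_subspaceT.
- by rewrite k2pi ge_min le_max; apply/andP; split; apply/orP; [right|left]; lra.
have := cosk u; rewrite ku.
have -> : k 0 - pi = - (pi - k 0) by ring.
rewrite cosN cosB cospi sinpi cosk; lra.
Qed.

(** By compactness [G] maps closed subsets of [[0, 1]] to closed sets, so [chi] descends to a
    continuous function on the trace, which Tietze's theorem extends to the plane. *)
Lemma continuous_on_trace (G : R -> R * R) (chi : R -> R) :
  continuous G -> continuous chi ->
  {in `[0, 1] &, forall s t, G s = G t -> chi s = chi t} ->
  exists phi : R * R -> R,
    continuous phi /\ {in `[0, 1], forall t, phi (G t) = chi t}.
Proof.
move=> cG cchi chiG; pose T := G @` `[0, 1].
have compG (A : set R) : closed A -> compact (G @` (`[0, 1] `&` A)).
  move=> clA; apply: continuous_compact; first exact: continuous_subspaceT.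
  by apply: compact_closedI => //; exact: segment_compact.
have closedG (A : set R) : closed A -> closed (G @` (`[0, 1] `&` A)).
  by move=> /compG; apply: compact_closed; exact: norm_hausdorff.
have [phi0 phi0E] : exists phi0 : R * R -> R,
    {in `[0, 1], forall t, phi0 (G t) = chi t}.
  have /choice[phi0 phi0P] : forall p, exists x,
      forall t, t \in `[0, 1] -> G t = p -> chi t = x.
    move=> p; have [[t t01 <-]|nT] := pselect (T p).
      by exists (chi t) => s s01 /chiG; apply.
    by exists 0 => t t01 tp; case: nT; exists t.
  by exists phi0 => t t01; rewrite -(phi0P (G t) t).
have cphi0 : {within T, continuous phi0}.
  apply/continuous_closedP => B clB; apply/closed_subspaceP.
  exists (G @` (`[0, 1] `&` chi @^-1` B)).
    by apply: closedG; apply: closed_comp => // x _; exact: cchi.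
  rewrite eqEsubset; split=> p [].
    move=> [t [t01 /= Bt] <-] _; split; last by exists t.
    by have := Bt; rewrite -(phi0E t t01).
  move=> /= Bp [t t01 tp]; split; last by exists t.
  by exists t => //; split => //=; rewrite -phi0E// tp.
have clT : closed T.
  by have := closedG _ closedT; rewrite setIT.
(* The extension theorem is applied to a bounded function; the bound is the maximum of [|chi|] on
   [[0, 1]], raised by 1 to be positive. *)
have [M M0 chiM] : exists2 M, 0 < M & forall p, T p -> `|phi0 p| <= M.
  have [c _ cP] := @EVT_max R (fun t => `|chi t|) 0 1 ler01
    (continuous_subspaceT (fun t => continuous_comp (cchi t) (@norm_continuous _ _ _))).
  exists (`|chi c| + 1); first by rewrite ltr_wpDl.
  by move=> _ [t t01 <-]; rewrite phi0E// (le_trans (cP _ t01))// lerDl.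
have [phi [phiE cphi _]] :=
  continuous_bounded_extension pseudometric_normal clT M0 cphi0 chiM.
exists phi; split=> // t t01.
by rewrite -phiE ?phi0E// inE; exists t.
Qed.

(** Pasting along the two closed sets [Q] with [T] and the complement of [Q], which cover the plane
    and overlap in the part of [T] outside [Q]. *)
Lemma continuous_glue (Q T : set (R * R)) (f g : R * R -> R) :
  open Q -> closed (Q `|` T) ->
  (forall p, (Q `|` T) p -> {for p, continuous f}) ->
  (forall p, ~ Q p -> {for p, continuous g}) ->
  (forall p, ~ Q p -> T p -> f p = g p) ->
  continuous (fun p => if pselect (Q p) then f p else g p).
Proof.
move=> oQ clQT cf cg fg; set h := fun p => _.
have clQ : closed (~` Q) by exact: open_closedC.
apply/continuous_subspace_setT.
have -> : [set: R * R] = (Q `|` T) `|` ~` Q.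
  by apply/esym/seteqP; split=> // p _; have [?|?] := pselect (Q p); [left; left|right].
apply: withinU_continuous => //.
  have fh : {in Q `|` T, f =1 h}.
    move=> p /set_mem QTp; rewrite /h; case: pselect => // nQ.
    by apply: fg => //; case: QTp.
  apply: (subspace_eq_continuous fh).
  by apply: continuous_in_subspaceT => p /set_mem; exact: cf.
have gh : {in ~` Q, g =1 h}.
  by move=> p /set_mem nQp; rewrite /h; case: pselect.
apply: (subspace_eq_continuous gh).
by apply: continuous_in_subspaceT => p /set_mem; exact: cg.
Qed.

(* [theta] and [psi] are determinations of the arguments of [G - z] and of
   [f o G]. If [f] had no zero on [Q], then [f / |f|] on [Q], continued by the
   radial field from [z] turned by an extension of [psi - theta], would be a
   map to the unit circle which is homotopic to the radial field on large
   circles. *)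
Lemma winding_zero (Q : set (R * R)) (G : R -> R * R) (f1 f2 : R * R -> R)
    (theta psi : R -> R) (z : R * R) M :
  let T := G @` `[0, 1] in
  open Q -> closed (Q `|` T) -> Q z -> 0 < M ->
  (forall u, ~ Q (z + (M * cos u, M * sin u))) ->
  continuous G -> continuous f1 -> continuous f2 ->
  continuous theta -> continuous psi ->
  {in `[0, 1] &, forall s t, G s = G t -> psi s - theta s = psi t - theta t} ->
  (forall t, t \in `[0, 1] ->
    let r := N ((G t).1 - z.1) ((G t).2 - z.2) in
    (G t).1 - z.1 = r * cos (theta t) /\ (G t).2 - z.2 = r * sin (theta t)) ->
  (forall t, t \in `[0, 1] -> let r := N (f1 (G t)) (f2 (G t)) in
    [/\ 0 < r, f1 (G t) = r * cos (psi t) & f2 (G t) = r * sin (psi t)]) ->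
  exists w, [/\ Q w, f1 w = 0 & f2 w = 0].
Proof.
move=> T oQ clQT Qz M0 nQM cG cf1 cf2 ctheta cpsi psitheta thetaP psiP.
apply: contrapT => nz.
have Ngt0 (a b : R) : a != 0 \/ b != 0 -> 0 < N a b.
  by move=> ab; rewrite sqrtr_gt0; case: ab => /eqP ?; nra.
have N2 (a b : R) : N a b ^+ 2 = a ^+ 2 + b ^+ 2.
  by rewrite sqr_sqrtr// addr_ge0// sqr_ge0.
have [phi [cphi phiE]] : exists phi : R * R -> R, continuous phi /\
    {in `[0, 1], forall t, phi (G t) = psi t - theta t}.
  by apply: continuous_on_trace => // t; apply: continuousB; [exact: cpsi|exact: ctheta].
pose nf p := N (f1 p) (f2 p).
have nf0 p : (Q `|` T) p -> 0 < nf p.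
  move=> [Qp|[t t01 <-]]; last by have [] := psiP t t01.
  apply: Ngt0; have [f10|] := eqVneq (f1 p) 0; last by left.
  by right; apply/eqP => f20; apply: nz; exists p.
pose c1 (p : R * R) := p.1 - z.1; pose c2 (p : R * R) := p.2 - z.2.
pose nc p := N (c1 p) (c2 p).
have nc0 p : ~ Q p -> 0 < nc p.
  move=> nQp; apply: Ngt0; rewrite !subr_eq0.
  have [p1|] := eqVneq p.1 z.1; last by left.
  right; apply/eqP => p2; apply: nQp.
  by move: Qz; rewrite [z]surjective_pairing -p1 -p2 -surjective_pairing.
have cc1 : continuous c1.
  by move=> p; apply: (@continuousB _ _ _ fst (fun=> z.1)); [exact: cvg_fst|exact: cvg_cst].
have cc2 : continuous c2.
  by move=> p; apply: (@continuousB _ _ _ snd (fun=> z.2)); [exact: cvg_snd|exact: cvg_cst].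
have ccos : continuous (fun p => cos (phi p)).
  by move=> p; apply: continuous_comp; [exact: cphi|exact: continuous_cos].
have csin : continuous (fun p => sin (phi p)).
  by move=> p; apply: continuous_comp; [exact: cphi|exact: continuous_sin].
(* [g1 + i g2] is the unit radial field from [z] multiplied by [e^(i phi)]. *)
pose g1 p := (cos (phi p) * c1 p - sin (phi p) * c2 p) / nc p.
pose g2 p := (sin (phi p) * c1 p + cos (phi p) * c2 p) / nc p.
have cdiv (h k : R * R -> R) p : {for p, continuous h} ->
    {for p, continuous k} -> 0 < k p -> {for p, continuous (fun q => h q / k q)}.
  move=> ch ck k0; apply: (@continuousM _ _ h (fun q => (k q)^-1)) => //.
  by apply: continuousV => //; rewrite gt_eqF.
have cg1 p : ~ Q p -> {for p, continuous g1}.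
  move=> nQp; apply: (cdiv _ nc); [|by apply: continuous_hypot; [exact: cc1|exact: cc2]|exact: nc0].
  apply: (@continuousB _ _ _ (fun p => cos (phi p) * c1 p) (fun p => sin (phi p) * c2 p));
    apply: continuousM; [exact: ccos|exact: cc1|exact: csin|exact: cc2].
have cg2 p : ~ Q p -> {for p, continuous g2}.
  move=> nQp; apply: (cdiv _ nc); [|by apply: continuous_hypot; [exact: cc1|exact: cc2]|exact: nc0].
  apply: (@continuousD _ _ _ (fun p => sin (phi p) * c1 p) (fun p => cos (phi p) * c2 p));
    apply: continuousM; [exact: csin|exact: cc1|exact: ccos|exact: cc2].
have cF1 p : (Q `|` T) p -> {for p, continuous (fun q => f1 q / nf q)}.
  by move=> /nf0; apply: cdiv (cf1 p) (continuous_hypot (cf1 p) (cf2 p)).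
have cF2 p : (Q `|` T) p -> {for p, continuous (fun q => f2 q / nf q)}.
  by move=> /nf0; apply: cdiv (cf2 p) (continuous_hypot (cf1 p) (cf2 p)).
(* On the trace [psi = phi + theta] is an angle of both maps, so they can be glued. *)
have fg t : t \in `[0, 1] -> ~ Q (G t) ->
    f1 (G t) / nf (G t) = g1 (G t) /\ f2 (G t) / nf (G t) = g2 (G t).
  move=> t01 nQt; have [f0 f1E f2E] := psiP t t01; have [c1E c2E] := thetaP t t01.
  have := nc0 _ nQt; rewrite /g1 /g2 /nf /nc /c1 /c2.
  set rf := N (f1 _) _ in f0 f1E f2E *; set rc := N _ _ in c1E c2E * => rc0.
  rewrite f1E f2E c1E c2E.
  have -> : psi t = phi (G t) + theta t by rewrite phiE// subrK.
  by rewrite cosD sinD; split; field; rewrite !gt_eqF.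
pose X p := if pselect (Q p) then f1 p / nf p else g1 p.
pose Y p := if pselect (Q p) then f2 p / nf p else g2 p.
have cX : continuous X.
  apply: (@continuous_glue Q T) => // p nQ [t t01 tp].
  by move: nQ; rewrite -tp => nQ; have [] := fg t t01 nQ.
have cY : continuous Y.
  apply: (@continuous_glue Q T) => // p nQ [t t01 tp].
  by move: nQ; rewrite -tp => nQ; have [] := fg t t01 nQ.
have XY1 p : X p ^+ 2 + Y p ^+ 2 = 1.
  rewrite /X /Y; case: pselect => [Qp|nQp].
    have r0 := nf0 _ (or_introl Qp); have := N2 (f1 p) (f2 p); rewrite -/(nf p).
    by move=> r2; rewrite !expr_div_n -mulrDl -r2 divff// expf_neq0// gt_eqF.
  have r0 := nc0 _ nQp; have := N2 (c1 p) (c2 p); rewrite -/(nc p) => r2.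
  rewrite /g1 /g2 !expr_div_n -mulrDl.
  have -> : (cos (phi p) * c1 p - sin (phi p) * c2 p) ^+ 2 +
     (sin (phi p) * c1 p + cos (phi p) * c2 p) ^+ 2 =
     (cos (phi p) ^+ 2 + sin (phi p) ^+ 2) * (c1 p ^+ 2 + c2 p ^+ 2) by ring.
  by rewrite cos2Dsin2 mul1r -r2 divff// expf_neq0// gt_eqF.
(* The circle of radius [M] about [z] avoids [Q], so on it the glued map is the radial field turned
   by [phi]. *)
apply: (circle_map_no_ext (ltW M0) cX cY XY1 cphi (z := z)) => u w.
rewrite /X /Y; case: pselect => [/nQM//|nQw].
have c1w : c1 w = M * cos u by rewrite /c1 /w /= addrC addKr.
have c2w : c2 w = M * sin u by rewrite /c2 /w /= addrC addKr.
have ncw : nc w = M.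
  rewrite /nc c1w c2w !exprMn -mulrDr cos2Dsin2 mulr1 sqrtr_sqr gtr0_norm//.
rewrite /g1 /g2 ncw c1w c2w cosD sinD.
by split; field; rewrite gt_eqF.
Qed.

End WindingZero.

(** * Distance functions of arcs, and the angle pi/3 *)

Section Distance.
Context {R : realType}.
Implicit Types (p q w : R * R) (a b s t : R).

(** The retraction of the line onto [[a, b]]; composing with it turns continuity within the interval
    into continuity everywhere. *)
Definition clamp a b t := Num.max a (Num.min b t).

Lemma clamp_itv a b t : a <= b -> clamp a b t \in `[a, b].
Proof. by move=> ab; rewrite /clamp in_itv /= le_max lexx ge_max ab ge_min lexx. Qed.

Lemma clamp_id a b t : t \in `[a, b] -> clamp a b t = t.
Proof.
by rewrite /clamp in_itv /= => /andP[at_ tb]; rewrite min_r// max_r.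
Qed.

Lemma clamp_le a b t : a <= b -> t <= a -> clamp a b t = a.
Proof. by move=> ab ta; rewrite /clamp min_r ?(le_trans ta)// max_l. Qed.

Lemma clamp_ge a b t : a <= b -> b <= t -> clamp a b t = b.
Proof. by move=> ab bt; rewrite /clamp min_l// max_r. Qed.

Lemma clamp_continuous a b : continuous (clamp a b).
Proof.
move=> t; apply: (@continuous_max _ _ (fun=> a)); first exact: cvg_cst.
by apply: (@continuous_min _ _ (fun=> b)); [exact: cvg_cst|exact: cvg_id].
Qed.

Lemma continuous_clamp (T : topologicalType) (f : R -> T) a b : a <= b ->
  {within `[a, b], continuous f} -> continuous (f \o clamp a b).
Proof.
move=> ab /subspace_continuousP fc t.
have cab := clamp_itv t ab.
apply: (@cvg_comp _ _ _ (clamp a b) f _ (within `[a, b] (nbhs (clamp a b t)))).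
  move=> B wB; have := @clamp_continuous a b t _ wB.
  change (
    (\forall s \near t, `[a, b]%classic (clamp a b s) -> B (clamp a b s)) ->
    \forall s \near t, B (clamp a b s)).
  by apply: filterS => s; apply; exact: clamp_itv.
exact: fc.
Qed.

(** Defined by hand because the norm of [R * R] is the maximum norm, not the Euclidean one. *)
Definition edist p q : R := Num.sqrt ((p.1 - q.1) ^+ 2 + (p.2 - q.2) ^+ 2).

Lemma edistE p q : (edist p q)%:C = `|(p.1 +i* p.2) - (q.1 +i* q.2) : R[i]|.
Proof. by rewrite normc_def. Qed.

Lemma edist_ge0 p q : 0 <= edist p q. Proof. exact: sqrtr_ge0. Qed.

Lemma edistC p q : edist p q = edist q p.
Proof. by apply: complexI; rewrite !edistE distrC. Qed.

Lemma edistpp p : edist p p = 0.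
Proof. by apply: complexI; rewrite edistE subrr normr0. Qed.

Lemma edist_eq0 p q : edist p q = 0 -> p = q.
Proof.
move=> pq0; have := edistE p q; rewrite pq0 => /esym/normr0_eq0/subr0_eq[].
by case: p q {pq0} => [? ?] [? ?] /= -> ->.
Qed.

Lemma edist_triangle q p w : edist p w <= edist p q + edist q w.
Proof.
rewrite -lecR [leRHS]rmorphD /= !edistE.
by apply: le_trans (ler_normD _ _); rewrite subrKA.
Qed.

Lemma edist_continuous (T : topologicalType) (f g : T -> R * R) x :
  {for x, continuous f} -> {for x, continuous g} ->
  {for x, continuous (fun y => edist (f y) (g y))}.
Proof.
move=> cf cg.
have c1 (h : T -> R * R) : {for x, continuous h} ->
    {for x, continuous (fun y => (h y).1)}.
  by move=> ch; apply: (@continuous_comp _ _ _ h fst); [exact: ch|exact: cvg_fst].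
have c2 (h : T -> R * R) : {for x, continuous h} ->
    {for x, continuous (fun y => (h y).2)}.
  by move=> ch; apply: (@continuous_comp _ _ _ h snd); [exact: ch|exact: cvg_snd].
apply: continuous_hypot.
  by apply: (@continuousB _ _ _ (fun y => (f y).1) (fun y => (g y).1)); exact: c1.
by apply: (@continuousB _ _ _ (fun y => (f y).2) (fun y => (g y).2)); exact: c2.
Qed.

Lemma edist_nbhs p e : 0 < e -> \forall q \near p, edist p q < e.
Proof.
move=> e0; have cE : {for p, continuous (edist p)}.
  by apply: edist_continuous; [exact: cvg_cst|exact: cvg_id].
have := cE [set x | x < e] _; apply; rewrite edistpp.
by apply: open_nbhs_nbhs; split => //; exact: open_lt.
Qed.

(** The minimum is attained by compactness. The nearest point may jump with [p], but the triangle
    inequality makes the distance 1-Lipschitz. *)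
Lemma arc_distance (G : R -> R * R) a b : continuous G -> a <= b ->
  exists d : R * R -> R, [/\ continuous d,
    forall p, exists2 t, t \in `[a, b] & d p = edist (G t) p &
    forall p t, t \in `[a, b] -> d p <= edist (G t) p].
Proof.
move=> cG ab.
have /choice[tt ttP] : forall p, exists t,
    t \in `[a, b] /\ forall s, s \in `[a, b] -> edist (G t) p <= edist (G s) p.
  move=> p; have cE : continuous (fun s => edist (G s) p).
    by move=> s; apply: edist_continuous; [exact: cG|exact: cvg_cst].
  have [t tab tP] := EVT_min ab (continuous_subspaceT cE).
  by exists t.
pose d p := edist (G (tt p)) p.
have dle p t : t \in `[a, b] -> d p <= edist (G t) p by have [_] := ttP p; apply.
exists d; split=> //; last by move=> p; exists (tt p) => //; have [] := ttP p.
have lip p q : d p <= d q + edist p q.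
  apply: (le_trans (dle p (tt q) _)); first by have [] := ttP q.
  by rewrite (edistC p); exact: edist_triangle.
move=> p; apply/cvgrPdist_lt => e e0.
have := edist_nbhs p e0.
apply: filterS => q pq; apply: le_lt_trans pq.
rewrite ler_norml lerBlDr [_ + d q]addrC lip andbT lerBrDr addrC lerBlDr.
by rewrite edistC lip.
Qed.

(** The cosine of this angle is 1/2, so the triple angle has cosine -1; being between 0 and 3 pi/2,
    it is pi. *)
Lemma atan_sqrt3 : 3 * atan (Num.sqrt 3) = pi :> R.
Proof.
set al := atan _; have s3 : Num.sqrt 3 ^+ 2 = 3 :> R by rewrite sqr_sqrtr.
have cE : cos al = 2^-1.
  rewrite cos_atan s3 (_ : 1 + 3 = 2 ^+ 2); last by ring.
  by rewrite sqrtr_sqr ger0_norm.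
have al0 : 0 < al.
  by rewrite /al -[X in X < _]atan0 lt_atan// sqrtr_gt0.
have alpi : al < pi / 2 by exact: atan_ltpi2.
have c3 : cos (3 * al) = -1.
  have -> : 3 * al = al + (al + al) by ring.
  have := cos2Dsin2 al; rewrite !cosD sinD cE => sE.
  have -> : 2^-1 * (2^-1 * 2^-1 - sin al * sin al) -
      sin al * (sin al * 2^-1 + 2^-1 * sin al) =
      2^-1 ^+ 3 - 3 / 2 * sin al ^+ 2 by field.
  have -> : sin al ^+ 2 = 1 - 2^-1 ^+ 2 by apply/eqP; rewrite eq_sym subr_eq addrC sE.
  by field.
(* [acos] inverts [cos] only on [[0, pi]]; beyond pi it is applied to [3 * al - pi], whose cosine is
   1. *)
have [al3|al3] := leP (3 * al) pi.
  by rewrite -[LHS]cosK ?c3 ?acosN1// in_itv /= al3 mulr_ge0// ltW.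
have : cos (3 * al - pi) = 1 by rewrite cosB cospi sinpi c3; ring.
have : 3 * al - pi \in `[0, pi] by rewrite in_itv /=; apply/andP; split; lra.
by move=> /cosK + cE1; rewrite cE1 acos1 => /eqP; rewrite eq_sym subr_eq0 => /eqP.
Qed.

End Distance.

(** * A point equidistant from three arcs *)

Section InscribedCircle.
Context {R : realType}.

Local Notation N a b := (Num.sqrt ((a : R) ^+ 2 + b ^+ 2)).

(** In complex form [f1 + i f2 = e^(i beta) (a + i b)]: the modulus is kept and [beta] is added to
    the argument. *)
Lemma polar_rotate (a b beta : R) : 0 < a ->
  let f1 := cos beta * a - sin beta * b in
  let f2 := sin beta * a + cos beta * b in
  [/\ 0 < N f1 f2, f1 = N f1 f2 * cos (beta + atan (b / a)) &
      f2 = N f1 f2 * sin (beta + atan (b / a))].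
Proof.
move=> a0 f1 f2; have [aE bE] := cos_sin_atan b a0.
have -> : N f1 f2 = N a b.
  congr Num.sqrt; rewrite /f1 /f2.
  transitivity ((cos beta ^+ 2 + sin beta ^+ 2) * (a ^+ 2 + b ^+ 2)); first by ring.
  by rewrite cos2Dsin2 mul1r.
split; first by rewrite sqrtr_gt0 ltr_pwDl ?sqr_ge0// exprn_gt0.
  by rewrite cosD mulrBr mulrCA -aE mulrCA -bE.
by rewrite sinD mulrDr mulrCA -aE mulrCA -bE.
Qed.

Lemma trig_two_thirds_pi : let al := atan (Num.sqrt 3) : R in
  [/\ cos (2 * al) = - 2^-1, sin (2 * al) = Num.sqrt 3 / 2,
      cos (4 * al) = - 2^-1 & sin (4 * al) = - (Num.sqrt 3 / 2)].
Proof.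
move=> al; have s3 : Num.sqrt 3 ^+ 2 = 3 :> R by rewrite sqr_sqrtr.
have [] := cos_sin_atan (Num.sqrt 3 : R) ltr01.
rewrite divr1 -/al s3 expr1n (_ : 1 + 3 = 2 ^+ 2); last by ring.
rewrite sqrtr_sqr ger0_norm// => cE sE.
have {}cE : cos al = 2^-1 by apply: (@mulfI _ 2) => //; rewrite -cE divff.
have {}sE : sin al = Num.sqrt 3 / 2 by rewrite [in RHS]sE mulrC mulKf.
have c2 : cos (2 * al) = - 2^-1.
  rewrite mulr2n mulrDl mul1r cosD cE sE.
  transitivity (2^-1 ^+ 2 - Num.sqrt 3 ^+ 2 / 4 : R); first by field.
  by rewrite s3; field.
have s2 : sin (2 * al) = Num.sqrt 3 / 2.
  by rewrite mulr2n mulrDl mul1r sinD cE sE; field.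
have -> : 4 * al = 2 * al + 2 * al by ring.
rewrite cosD sinD c2 s2; split=> //; last by field.
transitivity (2^-1 ^+ 2 - Num.sqrt 3 ^+ 2 / 4 : R); first by field.
by rewrite s3; field.
Qed.

(* The angle of [x e^(-i pi/3) + y e^(i pi/3)]. *)
Let ang (x y : R) := atan (Num.sqrt 3 * (y - x) / (x + y)).

Let ang0l y : 0 < y -> ang 0 y = atan (Num.sqrt 3).
Proof. by move=> y0; rewrite /ang subr0 add0r mulfK// gt_eqF. Qed.

Let ang0r x : 0 < x -> ang x 0 = - atan (Num.sqrt 3).
Proof. by move=> x0; rewrite /ang sub0r addr0 mulrN mulNr mulfK ?atanN// gt_eqF. Qed.

(** The equidistant point is a zero given by [winding_zero]. The hypothesis on [w] and [e] expresses
    that a disk missing the trace lies wholly inside or wholly outside [Q], as it does for a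
    component of the complement. *)
Lemma inscribed_circle_three_arcs (Q : set (R * R)) (G : R -> R * R)
    (theta : R -> R) (z : R * R) (s1 s2 M : R) :
  continuous G -> G 0 = G 1 -> {in `[0, 1[ &, injective G} ->
  0 < s1 -> s1 < s2 -> s2 < 1 ->
  Q z -> 0 < M -> (forall u, ~ Q (z + (M * cos u, M * sin u))) ->
  (forall t, t \in `[0, 1] -> ~ Q (G t)) ->
  (forall w e, (forall t, t \in `[0, 1] -> e <= edist (G t) w) ->
     forall p q, edist p w < e -> edist q w < e -> Q p -> Q q) ->
  continuous theta -> theta 1 - theta 0 = 2 * pi ->
  (forall t, t \in `[0, 1] ->
    (G t).1 - z.1 = edist (G t) z * cos (theta t) /\
    (G t).2 - z.2 = edist (G t) z * sin (theta t)) ->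
  exists w r, [/\ Q w, 0 < r, forall t, t \in `[0, 1] -> r <= edist (G t) w &
    [/\ exists2 t, t \in `[0, s1] & edist (G t) w = r,
        exists2 t, t \in `[s1, s2] & edist (G t) w = r &
        exists2 t, t \in `[s2, 1] & edist (G t) w = r]].
Proof.
move=> cG G01 Ginj s10 s12 s21 Qz M0 nQM nQG QL ctheta theta01 thetaP.
have [d [cd dE dle]] := arc_distance cG (@ler01 R).
have [d1 [cd1 d1E d1le]] := arc_distance cG (ltW s10).
have [d2 [cd2 d2E d2le]] := arc_distance cG (ltW s12).
have [d3 [cd3 d3E d3le]] := arc_distance cG (ltW s21).
have d1_ge0 p : 0 <= d1 p by have [t _ ->] := d1E p; exact: edist_ge0.
have d2_ge0 p : 0 <= d2 p by have [t _ ->] := d2E p; exact: edist_ge0.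
have d3_ge0 p : 0 <= d3 p by have [t _ ->] := d3E p; exact: edist_ge0.
(* On the closed interval the only coincidence is the closing point. *)
have inj01 s t : s \in `[0, 1] -> t \in `[0, 1] -> G s = G t ->
    [\/ s = t, s = 0 /\ t = 1 | s = 1 /\ t = 0].
  rewrite !in_itv /= => /andP[s0 sle1] /andP[t0 tle1] Gst.
  move: sle1; rewrite le_eqVlt => /orP[/eqP s_eq|slt].
    move: tle1; rewrite le_eqVlt => /orP[/eqP t_eq|tlt].
      by apply: Or31; rewrite s_eq t_eq.
    apply: Or33; split => //; apply/esym/Ginj; rewrite ?in_itv/= ?lexx ?ltr01 ?t0//.
    by rewrite G01 -Gst s_eq.
  move: tle1; rewrite le_eqVlt => /orP[/eqP t_eq|tlt].
    apply: Or32; split => //; apply/Ginj; rewrite ?in_itv/= ?lexx ?ltr01 ?s0//.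
    by rewrite G01 Gst t_eq.
  by apply: Or31; apply: Ginj; rewrite // in_itv /= ?s0 ?t0.
(* Parameters of the middle arc lie strictly between 0 and 1, so a point common to all three arcs
   would have both parameters [s1] and [s2]. *)
have no3 p : d1 p = 0 -> d2 p = 0 -> d3 p = 0 -> False.
  have [t1 i1 ->] := d1E p; have [t2 i2 ->] := d2E p; have [t3 i3 ->] := d3E p.
  move=> /edist_eq0 e1 /edist_eq0 e2 /edist_eq0 e3.
  move: i1 i2 i3; rewrite !in_itv /= => /andP[? ?] /andP[? ?] /andP[? ?].
  have i1 : t1 \in `[0, 1] by rewrite in_itv /=; apply/andP; split; lra.
  have i2 : t2 \in `[0, 1] by rewrite in_itv /=; apply/andP; split; lra.
  have i3 : t3 \in `[0, 1] by rewrite in_itv /=; apply/andP; split; lra.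
  suff : s2 <= s1 by rewrite leNgt s12.
  have := inj01 _ _ i2 i1 (etrans e2 (esym e1)).
  have := inj01 _ _ i2 i3 (etrans e2 (esym e3)).
  by case=> [e23|[e23 e23']|[e23 e23']]; case=> [e21|[e21 e21']|[e21 e21']]; lra.
have d10 t : t \in `[0, s1] -> d1 (G t) = 0.
  by move=> ti; apply/eqP; rewrite eq_le d1_ge0 andbT (le_trans (d1le _ _ ti))// edistpp.
have d20 t : t \in `[s1, s2] -> d2 (G t) = 0.
  by move=> ti; apply/eqP; rewrite eq_le d2_ge0 andbT (le_trans (d2le _ _ ti))// edistpp.
have d30 t : t \in `[s2, 1] -> d3 (G t) = 0.
  by move=> ti; apply/eqP; rewrite eq_le d3_ge0 andbT (le_trans (d3le _ _ ti))// edistpp.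
have gt0 (x y : R) : 0 <= x -> 0 <= y -> ~ (x = 0 /\ y = 0) -> 0 < x + y.
  move=> x0 y0 xy; rewrite lt_neqAle addr_ge0// andbT eq_sym paddr_eq0//.
  by apply/andP => -[/eqP ? /eqP ?]; exact: xy.
have pos1 t : t \in `[0, s1] -> 0 < d2 (G t) + d3 (G t).
  by move=> /d10 d0; apply: gt0 => // -[]; exact: no3.
have pos2 t : t \in `[s1, s2] -> 0 < d3 (G t) + d1 (G t).
  by move=> /d20 d0; apply: gt0 => // -[d3t d1t]; exact: (no3 (G t)).
have pos3 t : t \in `[s2, 1] -> 0 < d1 (G t) + d2 (G t).
  by move=> /d30 d0; apply: gt0 => // -[d1t d2t]; exact: (no3 (G t)).
(* Clamping freezes the angle outside its arc; on the arc the denominator of [ang] is positive. *)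
have clc a b (h k : R * R -> R) : a <= b -> continuous h -> continuous k ->
    (forall t, t \in `[a, b] -> 0 < h (G t) + k (G t)) ->
    continuous (fun t => ang (h (G (clamp a b t))) (k (G (clamp a b t)))).
  move=> ab ch ck hk t; set u := clamp a b.
  have cGu : {for t, continuous (fun t => G (u t))}.
    by apply: (@continuous_comp _ _ _ u G); [exact: clamp_continuous|exact: cG].
  have chu : {for t, continuous (fun t => h (G (u t)))}.
    by apply: (@continuous_comp _ _ _ (fun t => G (u t)) h) => //; exact: ch.
  have cku : {for t, continuous (fun t => k (G (u t)))}.
    by apply: (@continuous_comp _ _ _ (fun t => G (u t)) k) => //; exact: ck.
  apply: (@continuous_comp _ _ _ (fun t => Num.sqrt 3 * (k (G (u t)) - h (G (u t)))
    / (h (G (u t)) + k (G (u t)))) (@atan R)); last exact: continuous_atan.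
  apply: continuousM.
    apply: continuousM; first exact: cvg_cst.
    exact: (continuousB cku chu).
  apply: continuousV; last exact: (continuousD chu cku).
  by rewrite gt_eqF// hk// clamp_itv.
pose al : R := atan (Num.sqrt 3).
pose a1 t := ang (d2 (G (clamp 0 s1 t))) (d3 (G (clamp 0 s1 t))).
pose a2 t := ang (d3 (G (clamp s1 s2 t))) (d1 (G (clamp s1 s2 t))).
pose a3 t := ang (d1 (G (clamp s2 1 t))) (d2 (G (clamp s2 1 t))).
(* On each arc two of the three terms [a_i] are constant, equal to [+- al], so
   that [psi] is [ang] on that arc turned by 0, [2 al] or [4 al]. *)
pose psi t := a1 t + a2 t + a3 t + 2 * al.
have cpsi : continuous psi.
  move=> t; apply: (@continuousD _ _ _ (fun t => a1 t + a2 t + a3 t) (fun=> 2 * al));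
    last exact: cvg_cst.
  apply: (@continuousD _ _ _ (fun t => a1 t + a2 t) a3); last first.
    exact: (clc _ _ _ _ (ltW s21) cd1 cd2 pos3).
  apply: (@continuousD _ _ _ a1 a2); first exact: (clc _ _ _ _ (ltW s10) cd2 cd3 pos1).
  exact: (clc _ _ _ _ (ltW s12) cd3 cd1 pos2).
have i10 : 0 \in `[0, s1] by rewrite in_itv /= lexx ltW.
have i11 : s1 \in `[0, s1] by rewrite in_itv /= lexx ltW.
have i21 : s1 \in `[s1, s2] by rewrite in_itv /= lexx ltW.
have i22 : s2 \in `[s1, s2] by rewrite in_itv /= lexx ltW.
have i32 : s2 \in `[s2, 1] by rewrite in_itv /= lexx ltW.
have i33 : 1 \in `[s2, 1] by rewrite in_itv /= lexx ltW.
have a1E t : t \in `[0, s1] -> a1 t = ang (d2 (G t)) (d3 (G t)).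
  by move=> ti; rewrite /a1 clamp_id.
have a2E t : t \in `[s1, s2] -> a2 t = ang (d3 (G t)) (d1 (G t)).
  by move=> ti; rewrite /a2 clamp_id.
have a3E t : t \in `[s2, 1] -> a3 t = ang (d1 (G t)) (d2 (G t)).
  by move=> ti; rewrite /a3 clamp_id.
have a1r t : s1 <= t -> a1 t = al.
  move=> ti; rewrite /a1 clamp_ge ?(ltW s10)// (d20 _ i21) ang0l//.
  by have := pos1 _ i11; rewrite (d20 _ i21) add0r.
have a2l t : t <= s1 -> a2 t = - al.
  move=> ti; rewrite /a2 clamp_le ?(ltW s12)// (d10 _ i11) ang0r//.
  by have := pos2 _ i21; rewrite (d10 _ i11) addr0.
have a2r t : s2 <= t -> a2 t = al.
  move=> ti; rewrite /a2 clamp_ge ?(ltW s12)// (d30 _ i32) ang0l//.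
  by have := pos2 _ i22; rewrite (d30 _ i32) add0r.
have a3l t : t <= s2 -> a3 t = - al.
  move=> ti; rewrite /a3 clamp_le ?(ltW s21)// (d20 _ i22) ang0r//.
  by have := pos3 _ i32; rewrite (d20 _ i22) addr0.
(* The starting point is also the end of the third arc, so [d3] vanishes there. *)
have a10 : a1 0 = - al.
  rewrite a1E//; have := pos1 _ i10.
  by rewrite G01 (d30 _ i33) addr0 => /ang0r.
have a31 : a3 1 = al.
  rewrite a3E//; have := pos3 _ i33.
  by rewrite -G01 (d10 _ i10) add0r => /ang0l.
(* [psi] runs from [- al] to [5 * al], and [6 * al] is a full turn. *)
have psi01 : psi 1 - psi 0 = 2 * pi.
  rewrite /psi a10 a31 (a1r 1) ?(a2r 1) ?(a2l 0) ?(a3l 0) -?atan_sqrt3 -/al; lra.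
(* [f1 + i f2 = 2 (- d1 + d2 e^(-i pi/3) + d3 e^(i pi/3))], so that on each arc
   [f] runs through one of the three sectors cut out by these directions. *)
pose f1 p := d2 p + d3 p - 2 * d1 p; pose f2 p := Num.sqrt 3 * (d3 p - d2 p).
have cf1 : continuous f1.
  move=> p; apply: (@continuousB _ _ _ (fun p => d2 p + d3 p) (fun p => 2 * d1 p)).
    exact: (continuousD (cd2 p) (cd3 p)).
  by apply: (@continuousM _ _ (fun=> 2) d1); [exact: cvg_cst|exact: cd1].
have cf2 : continuous f2.
  move=> p; apply: (@continuousM _ _ (fun=> Num.sqrt 3) (fun p => d3 p - d2 p)).
    exact: cvg_cst.
  exact: (continuousB (cd3 p) (cd2 p)).
have s3 : Num.sqrt 3 ^+ 2 = 3 :> R by rewrite sqr_sqrtr.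
have [c2al s2al c4al s4al] := trig_two_thirds_pi; rewrite -/al in c2al s2al c4al s4al.
have psiP t : t \in `[0, 1] -> let r := N (f1 (G t)) (f2 (G t)) in
    [/\ 0 < r, f1 (G t) = r * cos (psi t) & f2 (G t) = r * sin (psi t)].
  (* Turned back by [beta], [f] becomes [(x + y) + i sqrt 3 (y - x)], which lies in the right
     half-plane and has argument [ang x y]. *)
  have rot beta x y : 0 < x + y -> let b := Num.sqrt 3 * (y - x) in
      f1 (G t) = cos beta * (x + y) - sin beta * b ->
      f2 (G t) = sin beta * (x + y) + cos beta * b -> psi t = beta + ang x y ->
      let r := N (f1 (G t)) (f2 (G t)) in
      [/\ 0 < r, f1 (G t) = r * cos (psi t) & f2 (G t) = r * sin (psi t)].
    by move=> xy b f1E f2E ->; rewrite /= f1E f2E; exact: polar_rotate.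
  rewrite in_itv /= => /andP[t0 t1].
  have [ts1|/ltW ts1] := leP t s1.
    have ti : t \in `[0, s1] by rewrite in_itv /= t0.
    apply: (rot 0 _ _ (pos1 _ ti)).
    - by rewrite cos0 sin0 /f1 (d10 _ ti); ring.
    - by rewrite cos0 sin0 /f2; ring.
    - by rewrite /psi a1E// a2l// a3l ?(le_trans ts1 (ltW s12))//; ring.
  have [ts2|/ltW ts2] := leP t s2.
    have ti : t \in `[s1, s2] by rewrite in_itv /= ts1.
    apply: (rot (2 * al) _ _ (pos2 _ ti)).
    - rewrite c2al s2al /f1 (d20 _ ti).
      transitivity (- 2^-1 * (d3 (G t) + d1 (G t)) -
        Num.sqrt 3 ^+ 2 / 2 * (d1 (G t) - d3 (G t))); last by field.
      by rewrite s3; field.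
    - by rewrite c2al s2al /f2 (d20 _ ti); field.
    - by rewrite /psi a1r// a2E// a3l//; ring.
  have ti : t \in `[s2, 1] by rewrite in_itv /= ts2.
  apply: (rot (4 * al) _ _ (pos3 _ ti)).
  - rewrite c4al s4al /f1 (d30 _ ti).
    transitivity (- 2^-1 * (d1 (G t) + d2 (G t)) +
      Num.sqrt 3 ^+ 2 / 2 * (d2 (G t) - d1 (G t))); last by field.
    by rewrite s3; field.
  - by rewrite c4al s4al /f2 (d30 _ ti); field.
  - by rewrite /psi a1r ?(le_trans (ltW s12))// a2r// a3E//; ring.
(* Both angles gain 2 pi from 0 to 1, so their difference agrees at the closing point. *)
have psitheta : {in `[0, 1] &, forall s t, G s = G t ->
    psi s - theta s = psi t - theta t}.
  move=> s t s01 t01 Gst.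
  by have [->//|[-> ->]|[-> ->]] := inj01 _ _ s01 t01 Gst; lra.
have dgt0 p : ~ (G @` `[0, 1]) p -> 0 < d p.
  move=> nTp; have [t t01 dt] := dE p; rewrite dt lt_neqAle edist_ge0 andbT eq_sym.
  by apply/eqP => /edist_eq0 Gt; apply: nTp; exists t.
have nT p : Q p -> ~ (G @` `[0, 1]) p by move=> Qp [t t01 tp]; apply: (nQG t); rewrite ?tp.
(* The disk of radius [d p] about a point [p] off the trace misses the trace, so [QL] applies to it;
   openness here and closedness below both follow. *)
have oQ : open Q.
  rewrite openE => p Qp; have dp := dgt0 _ (nT _ Qp).
  have := edist_nbhs p dp; apply: filterS => q; rewrite edistC => qp.
  by apply: (QL p (d p) _ p q) => //; [exact: dle|rewrite edistpp].
have clQT : closed (Q `|` G @` `[0, 1]).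
  rewrite -[X in closed X]setCK; apply: open_closedC.
  rewrite openE => p /not_orP[nQp nTp]; have dp := dgt0 _ nTp.
  have := edist_nbhs p dp.
  apply: filterS => q; rewrite edistC => qp [Qq|[t t01 tq]].
    by apply: nQp; apply: (QL p (d p) _ q p) => //; [exact: dle|rewrite edistpp].
  by move: qp; rewrite /= -tq ltNge dle.
have [w [Qw w1 w2]] := winding_zero oQ clQT Qz M0 nQM cG cf1 cf2 ctheta cpsi
  psitheta thetaP psiP.
have d32 : d3 w = d2 w.
  move: w2 => /eqP; rewrite mulf_eq0 gt_eqF ?sqrtr_gt0//= subr_eq0 => /eqP //.
have d12 : d1 w = d2 w by move: w1; rewrite /f1 d32; lra.
exists w, (d2 w); split=> //.
- rewrite lt_neqAle d2_ge0 andbT eq_sym; apply/eqP => d20w.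
  by apply: (no3 w); rewrite ?d12 ?d32.
- move=> t; rewrite in_itv /= => /andP[t0 t1].
  have [ts1|/ltW ts1] := leP t s1; first by rewrite -d12 d1le// in_itv /= t0.
  have [ts2|/ltW ts2] := leP t s2; first by rewrite d2le// in_itv /= ts1.
  by rewrite -d32 d3le// in_itv /= ts2.
- split.
  + by have [t ti dt] := d1E w; exists t; rewrite // -dt.
  + by have [t ti dt] := d2E w; exists t; rewrite // -dt.
  + by have [t ti dt] := d3E w; exists t; rewrite // -dt.
Qed.

End InscribedCircle.

(** * Passage between [R * R] and the complex plane *)

Section Plane.
Context {R : realType}.
Implicit Types (p q w : R * R) (u v : plane R) (e r s t : R).

Definition of_coord p : plane R := p.1 +i* p.2.
Definition coord u : R * R := (complex.Re u, complex.Im u).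

Lemma of_coordK : cancel of_coord coord. Proof. by case. Qed.

Lemma coordK : cancel coord of_coord. Proof. by case. Qed.

Lemma norm_of_coord p q : `|of_coord p - of_coord q| = (edist p q)%:C.
Proof. by rewrite edistE. Qed.

Lemma ball_of_coord p e q : ball (of_coord p) e%:C (of_coord q) = (edist p q < e) :> Prop.
Proof. by rewrite -ball_normE /= norm_of_coord ltcR. Qed.

(** The order of [R[i]] relates only numbers with equal imaginary parts, so radii of balls are
    real. *)
Lemma gt0_complex (x : R[i]) : 0 < x -> exists2 r, 0 < r & x = r%:C.
Proof.
case: x => a b; rewrite ltcE /= => /andP[/eqP b0 a0].
by exists a => //; rewrite b0.
Qed.

Lemma of_coord_continuous : continuous of_coord.
Proof.
move=> p; apply/cvgrPdist_lt => x /gt0_complex[e e0 ->].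
by have := edist_nbhs p e0; apply: filterS => q; rewrite norm_of_coord ltcR.
Qed.

Lemma coord_continuous : continuous coord.
Proof.
move=> u; have near_u (f : plane R -> R) :
    (forall v, `|f u - f v| <= edist (coord u) (coord v)) -> {for u, continuous f}.
  move=> fle B /nbhs_ballP[e /= e0 eB]; apply/nbhs_ballP.
  exists e%:C; first by rewrite /= ltcR.
  move=> v; rewrite -[u]coordK -[v]coordK ball_of_coord => uv.
  by apply: eB; rewrite !coordK -ball_normE /=; exact: le_lt_trans uv.
apply: (@continuous_pair _ (plane R) (fun v => complex.Re v) (fun v => complex.Im v)); apply: near_u => v;
  rewrite -sqrtr_sqr ler_wsqrtr//= ?lerDl ?lerDr sqr_ge0//.
Qed.

(** Disks are convex, since the distance to [w] is a convex function along the segment. *)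
Lemma edist_segment w p q e s : edist p w < e -> edist q w < e -> 0 <= s <= 1 ->
  edist (p + s *: (q - p)) w < e.
Proof.
move=> pw qw /andP[s0 s1].
suff : edist (p + s *: (q - p)) w <= (1 - s) * edist p w + s * edist q w.
  move=> /le_lt_trans; apply; pose m := Num.max (edist p w) (edist q w).
  have : m < e by rewrite gt_max pw.
  have : edist p w <= m by rewrite le_max lexx.
  have : edist q w <= m by rewrite le_max lexx orbT.
  by move=> qm pm; apply: le_lt_trans; nra.
rewrite -lecR rmorphD !rmorphM /= -!norm_of_coord.
have nE (x : R) : 0 <= x -> x%:C = `|x%:C| :> R[i].
  by move=> x0; rewrite ger0_norm// ler0c.
rewrite [(1 - s)%:C]nE ?subr_ge0// [s%:C]nE// -!normrM.
apply: le_trans (ler_normD _ _).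
rewrite le_eqVlt; apply/orP; left; apply/eqP; congr (`|_|).
case: p q w {pw qw} => [p1 p2] [q1 q2] [w1 w2].
rewrite /of_coord /=; apply/eqP; rewrite eq_complex /=.
by apply/andP; split; apply/eqP; rewrite /GRing.scale /=; ring.
Qed.

Lemma segment_connected_plane p q :
  connected ((fun s => of_coord (p + s *: (q - p))) @` `[0, 1]).
Proof.
apply: connected_continuous_connected; first exact: segment_connected.
apply: continuous_subspaceT => s.
apply: (@continuous_comp _ _ _ (fun s => p + s *: (q - p)) of_coord);
  last exact: of_coord_continuous.
apply: (@continuousD _ _ _ (fun=> p) (fun s => s *: (q - p))); first exact: cvg_cst.
exact: scalel_continuous.
Qed.

(** Two points of the disk are joined by a segment inside it, hence inside [A], so the disk lies in
    a single component. *)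
Lemma connected_component_ball (A : set (plane R)) u w e :
  (forall p, edist p w < e -> A (of_coord p)) -> forall p q,
  edist p w < e -> edist q w < e ->
  connected_component A u (of_coord p) -> connected_component A u (of_coord q).
Proof.
move=> eA p q pw qw up; apply: connected_component_trans up _.
exists ((fun s => of_coord (p + s *: (q - p))) @` `[0, 1]).
  split; last exact: segment_connected_plane.
    by exists 0; rewrite ?scale0r ?addr0//= in_itv /= lexx ler01.
  by move=> _ [s /= si <-]; apply: eA; apply: edist_segment.
by exists 1; rewrite ?scale1r ?subrKC//= in_itv /= lexx ler01.
Qed.

(** The point is outside the open ball, but arbitrarily small moves towards the centre enter it. *)
Lemma frontier_ball w r p : 0 < r -> edist p w = r ->
  frontier (ball (of_coord w) r%:C) (of_coord p).
Proof.
move=> r0 pw; split; last first.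
  move=> /interior_subset; rewrite ball_of_coord edistC pw.
  by rewrite ltxx.
have cE : {for 0, continuous (fun s : R => of_coord (p + s *: (w - p)))}.
  apply: (@continuous_comp _ _ _ (fun s => p + s *: (w - p)) of_coord);
    last exact: of_coord_continuous.
  apply: (@continuousD _ _ _ (fun=> p) (fun s => s *: (w - p))); first exact: cvg_cst.
  exact: scalel_continuous.
move=> B nB; have := cE B; rewrite /= scale0r addr0 => /(_ nB) /nbhs_ballP[e /= e0 eB].
(* Below [e] the moved point stays in the given neighbourhood; [s <= 1] keeps the factor [1 - s] of
   the distance nonnegative. *)
pose s := Num.min (e / 2) 1.
have s0 : 0 < s by rewrite lt_min ltr01 divr_gt0.
have s1 : s <= 1 by rewrite ge_min lexx orbT.
have se : s < e by rewrite gt_min; apply/orP; left; lra.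
exists (of_coord (p + s *: (w - p))); split; last first.
  by apply: eB; rewrite -ball_normE /= sub0r normrN gtr0_norm.
rewrite ball_of_coord.
have -> : edist w (p + s *: (w - p)) = (1 - s) * edist p w.
  rewrite /edist -[1 - s]ger0_norm ?subr_ge0// -sqrtr_sqr -sqrtrM ?sqr_ge0//.
  by congr Num.sqrt; rewrite /= /GRing.scale /=; ring.
by rewrite pw; nra.
Qed.

End Plane.

(** * The inscribed disk of a Jordan quadrilateral *)

Theorem theorem1p1 (R : realType) (Q : set (plane R)) (v1 v2 v3 v4 : plane R)
    (a1 b1 a2 b2 : set (plane R)) :
  jordan_quadrilateral Q v1 v2 v3 v4 a1 b1 a2 b2 ->
  exists (c : plane R) (r : R),
    let D : set (plane R) := ball c r%:C in
    let contacts : set (plane R) := frontier D `&` frontier Q in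
    [/\ 0 < r,
        D `<=` Q,
        (3 <= count (fun s : set (plane R) => `[< touches contacts s >])
                    [:: a1; b1; a2; b2])%N &
        (touches contacts a1 /\ touches contacts a2) \/
        (touches contacts b1 /\ touches contacts b2)].
Proof.
move=> [gamma [t2 [t3 [t4 [[[cgam gam01 ginj] [bQ [z1 nz1 QE]] ccw]
  /and4P[t20 t23 t34 t41] _ [-> -> -> ->]]]]]].
have Q_notin t : t \in `[0, 1] -> ~ Q (gamma t).
  by move=> t01; rewrite QE => /connected_component_sub; apply; exists t.
pose G t := coord (gamma (clamp 0 1 t)).
have GE t : t \in `[0, 1] -> of_coord (G t) = gamma t.
  by move=> t01; rewrite /G clamp_id// coordK.
have cG : continuous G.
  move=> t; apply: (@continuous_comp _ _ _ (gamma \o clamp 0 1) coord).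
    exact: (continuous_clamp ler01 cgam).
  exact: coord_continuous.
have sub01 : {subset `[0, 1[ <= `[(0 : R), 1]}.
  by move=> t; rewrite !in_itv /= => /andP[-> /ltW].
have i0 : 0 \in `[(0 : R), 1] by rewrite in_itv /= lexx ler01.
have i1 : 1 \in `[(0 : R), 1] by rewrite in_itv /= lexx ler01.
have G01 : G 0 = G 1 by rewrite /G !clamp_id// gam01.
have Ginj : {in `[0, 1[ &, injective G}.
  by move=> s t si ti /(congr1 of_coord); rewrite !GE ?sub01//; exact: ginj.
have Qz1 : Q z1 by rewrite QE; exact: connected_component_refl.
have [theta [ctheta thetaP theta01]] := ccw _ Qz1.
pose th := theta \o clamp 0 1; pose z := coord z1.
have cth : continuous th by exact: (continuous_clamp ler01 ctheta).
have th01 : th 1 - th 0 = 2 * pi by rewrite /th /= !clamp_id// theta01 mul1r.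
have thP t : t \in `[0, 1] ->
    (G t).1 - z.1 = edist (G t) z * cos (th t) /\
    (G t).2 - z.2 = edist (G t) z * sin (th t).
  move=> t01; have := thetaP t t01; rewrite /th /= clamp_id//.
  rewrite -GE// -[z1]coordK -/z norm_of_coord => /eqP.
  rewrite eq_complex /= => /andP[/eqP + /eqP].
  by rewrite !mul0r subr0 addr0 => <- <-.
have [K KQ] : exists K : R, forall q, Q (of_coord q) -> edist q 0 <= K.
  (* Boundedness provides every number above [k] as a bound. *)
  move: bQ => -[x [/complex_realP[k ->] kQ]]; exists (k + 1) => q Qq.
  have := kQ (k + 1)%:C _ _ Qq; rewrite ltcR ltrDl ltr01 /= => /(_ isT).
  by rewrite -lecR edistE /= subr0.
have Qz : (Q \o of_coord) z by rewrite /= coordK.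
have K0 : 0 <= K by apply: le_trans (KQ _ Qz); exact: edist_ge0.
(* Points of [Q] are within [K + edist 0 z] of [z], so the circle of radius [M] about [z] misses
   [Q]. *)
pose M := K + edist 0 z + 1.
have M0 : 0 < M by rewrite ltr_wpDl// addr_ge0// edist_ge0.
have nQM u : ~ (Q \o of_coord) (z + (M * cos u, M * sin u)).
  move=> /= /KQ; set q := z + _ => qK.
  have qz : edist q z = M.
    rewrite /edist /q /= ![z.1 + _]addrC ![z.2 + _]addrC !addrK !exprMn -mulrDr.
    by rewrite cos2Dsin2 mulr1 sqrtr_sqr gtr0_norm.
  have := edist_triangle 0 q z; rewrite qz /M; lra.
have nQG t : t \in `[0, 1] -> ~ (Q \o of_coord) (G t).
  by move=> t01 /=; rewrite GE//; exact: Q_notin.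
have QL w e : (forall t, t \in `[0, 1] -> e <= edist (G t) w) ->
    forall p q, edist p w < e -> edist q w < e ->
    (Q \o of_coord) p -> (Q \o of_coord) q.
  move=> ew p q pw qw; rewrite /= QE; apply: (connected_component_ball _ pw qw).
  move=> y yw [t t01 ty]; have := ew t t01.
  by rewrite -(of_coordK y) -ty /G in yw *; rewrite /G clamp_id// leNgt yw.
(* The cuts [t2] and [t4] merge [b1] and [a2] into the middle arc. *)
have [w [r [Qw r0 rG [[s1 s1i s1r] [s2 s2i s2r] [s3 s3i s3r]]]]] :=
  inscribed_circle_three_arcs cG G01 Ginj t20 (lt_trans t23 t34) t41 Qz M0 nQM nQG
    QL cth th01 thP.
have DQ : ball (of_coord w) r%:C `<=` Q.
  move=> y; rewrite -[y]coordK ball_of_coord edistC => yw.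
  by apply: (QL w r rG w) => //; rewrite edistpp.
(* Such a point is in the closure of [Q] because the disk lies in [Q], and it is not interior
   because the trace misses [Q]. *)
have contact s : s \in `[0, 1] -> edist (G s) w = r ->
    (frontier (ball (of_coord w) r%:C) `&` frontier Q) (gamma s).
  move=> si sr; rewrite -GE//; have fs := frontier_ball r0 sr.
  split=> //; split; first by apply: (closureS DQ); case: fs.
  by move=> /interior_subset; exact: nQG.
exists (of_coord w), r => D contacts.
have t2i : t2 <= 1 by apply: ltW; lra.
have touch_a1 : touches contacts (gamma @` `[0, t2]).
  exists (gamma s1); split; last by exists s1.
  by apply: contact => //; move: s1i; rewrite !in_itv /= => /andP[-> /le_trans->].
have touch_b2 : touches contacts (gamma @` `[t4, 1]).
  exists (gamma s3); split; last by exists s3.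
  apply: contact => //; move: s3i; rewrite !in_itv /= => /andP[? ->].
  by rewrite andbT; lra.
have cs2 : contacts (gamma s2).
  apply: contact => //; move: s2i; rewrite !in_itv /= => /andP[? ?].
  by apply/andP; split; lra.
(* The contact on the merged arc lies on [b1] or on [a2], and pairs with the contact on [b2] or on
   [a1] respectively. *)
have [s23|/ltW s32] := leP s2 t3.
  have touch_b1 : touches contacts (gamma @` `[t2, t3]).
    exists (gamma s2); split=> //; exists s2 => //=.
    by move: s2i; rewrite !in_itv /= s23 => /andP[->].
  split=> //; last by right.
  by rewrite /= (asboolT touch_a1) (asboolT touch_b1) (asboolT touch_b2); case: `[< _ >].
have touch_a2 : touches contacts (gamma @` `[t3, t4]).
  exists (gamma s2); split=> //; exists s2 => //=.
  by move: s2i; rewrite !in_itv /= s32 => /andP[_ ->].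
split=> //; last by left.
by rewrite /= (asboolT touch_a1) (asboolT touch_a2) (asboolT touch_b2); case: `[< _ >].
Qed.
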